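(* Let $A$ be a finite-dimensional vector space over $\mathbb{K}$, let $(A,\circ_A)$ and $(A^*,\cdot_{A^*})$ be two Zinbiel algebras (on $A$ and on its dual space $A^*$), and let $\alpha:A\to A\otimes A$ and $\beta:A^*\to A^*\otimes A^*$ be the linear maps dual to the products, i.e. $\langle\alpha(x),\xi\otimes\eta\rangle=\langle x,\xi\cdot_{A^*}\eta\rangle$ and $\langle\beta(\xi),x\otimes y\rangle=\langle\xi,x\circ_A y\rangle$ for all $x,y\in A$, $\xi,\eta\in A^*$. Then the following conditions are equivalent: (i) $(A,A^* )=(A,A^*,\alpha,\beta)$ is a Zinbiel bialgebra. (ii) $(A,A^*;(-L^*-R^*,R^* ),(-\mathcal{L}^*-\mathcal{R}^*,\mathcal{R}^* ))$ is a matched pair of Zinbiel algebras. (iii) $(A\oplus A^*,A,A^* )$ is a Manin triple of Zinbiel algebras with respect to the skew-symmetric bilinear form $\omega(x+\xi,y+\eta)=\langle\xi,y\rangle-\langle\eta,x\rangle$; that is, there is a Zinbiel algebra structure on $A\oplus A^*$ which contains $(A,\circ_A)$ and $(A^*,\cdot_{A^*})$ as subalgebras and for which $(A\oplus A^*,A,A^* )$ with this $\omega$ is a Manin triple of Zinbiel algebras.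
   Context: All vector spaces are finite-dimensional over a field $\mathbb{K}$. A Zinbiel algebra $(A,\circ_A)$ is a vector space with a bilinear product satisfying $x\circ_A(y\circ_A z)=(x\circ_A y+y\circ_A x)\circ_A z$. Its sub-adjacent commutative associative algebra $A^c$ is $A$ with $x\ast_A y=x\circ_A y+y\circ_A x$. Write $L_x(y)=x\circ_A y$, $R_x(y)=y\circ_A x$, and $\langle L_x^*\xi,y\rangle=-\langle\xi,x\circ_A y\rangle$, $\langle R_x^*\xi,y\rangle=-\langle\xi,y\circ_A x\rangle$ for $\xi\in A^*$. For the Zinbiel algebra $(A^*,\cdot_{A^*})$ the left and right multiplications are $\mathcal{L}_\xi(\eta)=\xi\cdot_{A^*}\eta$, $\mathcal{R}_\xi(\eta)=\eta\cdot_{A^*}\xi$, and $\mathcal{L}^*_\xi,\mathcal{R}^*_\xi:A\to A$ are given by $\langle\mathcal{L}_\xi^*x,\eta\rangle=-\langle x,\xi\cdot_{A^*}\eta\rangle$, $\langle\mathcal{R}_\xi^*x,\eta\rangle=-\langle x,\eta\cdot_{A^*}\xi\rangle$. Also $\xi\ast_{A^*}\eta=\xi\cdot_{A^*}\eta+\eta\cdot_{A^*}\xi$. Representation: a triple $(V;\rho,\mu)$ with linear maps $\rho,\mu:A\to\mathrm{End}(V)$ such that $\rho(x)\rho(y)=\rho(x\circ_A y)+\rho(y\circ_A x)$ and $\rho(x)\mu(y)=\mu(x\circ_A y)=\mu(y)\rho(x)+\mu(y)\mu(x)$ for all $x,y\in A$. Matched pair of Zinbiel algebras $(A,B;(\rho,\mu),(\rho',\mu'))$: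 Zinbiel algebras $(A,\circ_A)$, $(B,\circ_B)$, a representation $(\rho,\mu)$ of $A$ on $B$ and a representation $(\rho',\mu')$ of $B$ on $A$ such that for all $x,y\in A$, $u,v\in B$: (1) $u\circ_B(\mu(x)v)+\mu(\rho'(v)x)u=\mu(x)(u\circ_B v+v\circ_B u)$; (2) $\rho(x)(u\circ_B v)-(\rho(x)u)\circ_B v=\rho(\mu'(u)x)v+(\mu(x)u)\circ_B v+\rho(\rho'(u)x)v$; (3) $u\circ_B(\rho(x)v)+\mu(\mu'(v)x)u-(\mu(x)u)\circ_B v=(\rho(x)u)\circ_B v+\rho(\mu'(u)x)v+\rho(\rho'(u)x)v$; (4) $x\circ_A(\mu'(u)y)+\mu'(\rho(y)u)x=\mu'(u)(x\circ_A y+y\circ_A x)$; (5) $\rho'(u)(x\circ_A y)-(\rho'(u)x)\circ_A y=\rho'(\mu(x)u)y+(\mu'(u)x)\circ_A y+\rho'(\rho(x)u)y$; (6) $x\circ_A(\rho'(u)y)+\mu'(\mu(y)u)x-(\mu'(u)x)\circ_A y=(\rho'(u)x)\circ_A y+\rho'(\mu(x)u)y+\rho'(\rho(x)u)y$. Quadratic Zinbiel algebra: a Zinbiel algebra $(\mathcal{A},\circ)$ with a nondegenerate skew-symmetric bilinear form $\omega\in\wedge^2\mathcal{A}^*$ such that $\omega(x\circ y,z)=\omega(y,x\circ z+z\circ x)$ for all $x,y,z$. Manin triple of Zinbiel algebras: a triple $(\mathcal{A},A_1,A_2)$ where $(\mathcal{A},\circ,\omega)$ is a quadratic Zinbiel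 algebra, $A_1,A_2$ are subalgebras isotropic with respect to $\omega$, and $\mathcal{A}=A_1\oplus A_2$ as vector spaces. Zinbiel bialgebra $(A,A^*,\alpha,\beta)$: linear maps $\alpha:A\to A\otimes A$, $\beta:A^*\to A^*\otimes A^*$ such that $\alpha^*:A^*\otimes A^*\to A^*$ is a Zinbiel algebra structure on $A^*$, $\beta^*:A\otimes A\to A$ is a Zinbiel algebra structure on $A$, $\alpha$ is a 1-cocycle of $A^c$ with coefficients in $(A\otimes A;L\otimes\mathrm{Id}+\mathrm{Id}\otimes(L+R))$, meaning $\alpha(x\ast_A y)=(L_x\otimes\mathrm{Id})\alpha(y)+(\mathrm{Id}\otimes(L_y+R_y))\alpha(x)$ for all $x,y\in A$, and $\beta$ is a 1-cocycle of $A^{*c}$ with coefficients in $(A^*\otimes A^*;\mathcal{L}\otimes\mathrm{Id}+\mathrm{Id}\otimes(\mathcal{L}+\mathcal{R}))$, meaning $\beta(\xi\ast_{A^*}\eta)=(\mathcal{L}_\xi\otimes\mathrm{Id})\beta(\eta)+(\mathrm{Id}\otimes(\mathcal{L}_\eta+\mathcal{R}_\eta))\beta(\xi)$ for all $\xi,\eta\in A^*$. *)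

(* Defs.v *)
From HB Require Import structures.
From mathcomp Require Import all_boot all_order all_algebra.

Set Implicit Arguments.
Unset Strict Implicit.
Unset Printing Implicit Defensive.

Import GRing.Theory.
Local Open Scope ring_scope.

Section Duality.
Variable K : fieldType.
Implicit Types U V W : vectType K.

Definition dual V : vectType K := 'Hom(V, K^o).

(* <phi, x> *)
Definition pairing V (phi : dual V) (x : V) : K := (phi : 'Hom(V, K^o)) x.

Definition transpose U V (f : 'Hom(U, V)) : 'Hom(dual V, dual U) :=
  linfun (fun phi : dual V => ((phi : 'Hom(V, K^o)) \o f)%VF : dual U).

Definition ev_at V (x : V) : dual (dual V) :=
  linfun (fun phi : dual V => pairing phi x : K^o).

Definition ev V : 'Hom(V, dual (dual V)) := linfun (@ev_at V).

Definition ev_inv V : 'Hom(dual (dual V), V) := (ev V)^-1%VF.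

Lemma linfunE U V (f : U -> V) : linear f -> linfun f =1 f.
Proof.
move=> lin x; pose M := GRing.isLinear.Build _ _ _ _ f lin.
pose h : {linear U -> V} := HB.pack f M.
exact: (lfunE h).
Qed.

Lemma dualP V (phi psi : dual V) : pairing phi =1 pairing psi -> phi = psi.
Proof. by move=> e; apply/lfunP => x; apply: e. Qed.

Lemma pairingDl V (phi psi : dual V) x :
  pairing (phi + psi) x = pairing phi x + pairing psi x.
Proof. exact: (@add_lfunE K V K^o phi psi x). Qed.

Lemma pairingNl V (phi : dual V) x : pairing (- phi) x = - pairing phi x.
Proof. exact: (@opp_lfunE K V K^o phi x). Qed.

Lemma pairingZl V a (phi : dual V) x : pairing (a *: phi) x = a * pairing phi x.
Proof. exact: (@scale_lfunE K V K^o a phi x). Qed.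

Lemma pairing0l V x : pairing (0 : dual V) x = 0.
Proof. exact: (@zero_lfunE K V K^o x). Qed.

Lemma pairingDr V (phi : dual V) x y :
  pairing phi (x + y) = pairing phi x + pairing phi y.
Proof. exact: (linearD (phi : 'Hom(V, K^o))). Qed.

Lemma pairingNr V (phi : dual V) x : pairing phi (- x) = - pairing phi x.
Proof. exact: (linearN (phi : 'Hom(V, K^o))). Qed.

Lemma pairingZr V a (phi : dual V) x : pairing phi (a *: x) = a * pairing phi x.
Proof. by rewrite /pairing linearZ. Qed.

Lemma pairing0r V (phi : dual V) : pairing phi 0 = 0.
Proof. exact: (linear0 (phi : 'Hom(V, K^o))). Qed.

Definition pairingl := (pairingDl, pairingNl, pairingZl, pairing0l).
Definition pairingr := (pairingDr, pairingNr, pairingZr, pairing0r).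

Lemma transposeE U V (f : 'Hom(U, V)) phi x :
  pairing (transpose f phi) x = pairing phi (f x).
Proof.
have compE (psi : dual V) y :
    pairing ((psi : 'Hom(V, K^o)) \o f)%VF y = pairing psi (f y).
  exact: (comp_lfunE (psi : 'Hom(V, K^o))).
rewrite /transpose linfunE ?compE // => a u v.
by apply: dualP => y; rewrite compE !pairingl !compE.
Qed.

Lemma ev_atE V (x : V) (phi : dual V) : pairing (ev_at x) phi = pairing phi x.
Proof.
apply: (@linfunE (dual V) K^o (fun phi => pairing phi x)) => a u v.
by rewrite !pairingl.
Qed.

Lemma evE V (x : V) (phi : dual V) : pairing (ev V x) phi = pairing phi x.
Proof.
rewrite /ev linfunE ?ev_atE // => a u v; apply: dualP => f.
by rewrite !pairingl !ev_atE !pairingr.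
Qed.

Definition dbasis V (i : 'I_(\dim {:V})) : dual V :=
  linfun (fun x => coord (vbasis {:V}) i x : K^o).

Lemma dbasisE V (i : 'I_(\dim {:V})) (x : V) :
  pairing (dbasis i) x = coord (vbasis {:V}) i x.
Proof.
apply: (@linfunE V K^o (fun x => coord (vbasis {:V}) i x)) => a u v.
by rewrite linearP.
Qed.

Lemma vbasis_sum V (x : V) :
  x = \sum_(i < \dim {:V}) pairing (dbasis i) x *: (vbasis {:V})`_i.
Proof.
rewrite {1}[x](coord_vbasis (memvf x)).
by apply: eq_bigr => i _; rewrite dbasisE.
Qed.

Lemma pairing_suml V I (r : seq I) (P : pred I) (F : I -> dual V) x :
  pairing (\sum_(i <- r | P i) F i) x = \sum_(i <- r | P i) pairing (F i) x.
Proof. exact: (@sum_lfunE K V K^o I r P F x). Qed.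

Lemma pairing_sumr V I (r : seq I) (P : pred I) (phi : dual V) (F : I -> V) :
  pairing phi (\sum_(i <- r | P i) F i) = \sum_(i <- r | P i) pairing phi (F i).
Proof. exact: (linear_sum (phi : 'Hom(V, K^o))). Qed.

Lemma dual_sum V (phi : dual V) :
  phi = \sum_(i < \dim {:V}) pairing phi (vbasis {:V})`_i *: dbasis i.
Proof.
apply: dualP => x; rewrite {1}[x]vbasis_sum pairing_sumr pairing_suml.
by apply: eq_bigr => i _; rewrite pairingZr pairingZl mulrC.
Qed.

Lemma dual_inj V (x y : V) :
  (forall phi, pairing phi x = pairing phi y) -> x = y.
Proof.
move=> exy; rewrite [x]vbasis_sum [y]vbasis_sum.
by apply: eq_bigr => i _; rewrite exy.
Qed.

Lemma lker_ev V : lker (ev V) == 0%VS.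
Proof.
by apply/lker0P => x y exy; apply: dual_inj => phi; rewrite -(evE x) exy evE.
Qed.

Lemma dim_dual V : \dim {:dual V} = \dim {:V}.
Proof. by rewrite !dimvf -[RHS]muln1. Qed.

Lemma limg_ev V : limg (ev V) = fullv.
Proof.
apply/eqP; rewrite eqEdim subvf /= limg_dim_eq; last first.
  by rewrite (eqP (lker_ev V)) capv0.
by rewrite !dim_dual.
Qed.

Lemma evK V : cancel (ev V) (ev_inv V).
Proof. by apply: lker0_lfunK; exact: lker_ev. Qed.

Lemma ev_invK V : cancel (ev_inv V) (ev V).
Proof. by move=> f; apply: limg_lfunVK; rewrite limg_ev memvf. Qed.

Lemma ev_invE V (f : dual (dual V)) (phi : dual V) :
  pairing phi (ev_inv V f) = pairing f phi.
Proof. by rewrite -evE ev_invK. Qed.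

End Duality.

Section Tensor.
Variable K : fieldType.
Implicit Types U V W : vectType K.

(* In finite dimension, U (x) V is modelled by 'Hom(U^*, V), the pure tensor
   u (x) v being phi |-> <phi, u> v; see [tens_universal]. *)
Definition tens U V : vectType K := 'Hom(dual U, V).

Definition ptens U V (u : U) (v : V) : tens U V :=
  linfun (fun phi : dual U => pairing phi u *: v).

Definition contract U V (T : tens U V) (phi : dual U) : V :=
  (T : 'Hom(dual U, V)) phi.

(* <T, phi (x) psi> *)
Definition tpair U V (T : tens U V) (phi : dual U) (psi : dual V) : K :=
  pairing psi (contract T phi).

(* f (x) g *)
Definition tmap U V U' V' (f : 'Hom(U, U')) (g : 'Hom(V, V')) (T : tens U V) :
    tens U' V' :=
  (g \o (T : 'Hom(dual U, V)) \o transpose f)%VF.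

Lemma tensP U V (S T : tens U V) : contract S =1 contract T -> S = T.
Proof. by move=> e; apply/lfunP => x; apply: e. Qed.

Lemma contractPl U V a (S T : tens U V) phi :
  contract (a *: S + T) phi = a *: contract S phi + contract T phi.
Proof. by rewrite /contract add_lfunE scale_lfunE. Qed.

Lemma contractPr U V a (T : tens U V) phi psi :
  contract T (a *: phi + psi) = a *: contract T phi + contract T psi.
Proof. exact: (linearP (T : 'Hom(dual U, V))). Qed.

Lemma ptensE U V (u : U) (v : V) phi :
  contract (ptens u v) phi = pairing phi u *: v.
Proof.
apply: (@linfunE K (dual U) V (fun phi => pairing phi u *: v)) => a f g.
by rewrite !pairingl scalerDl scalerA.
Qed.

Lemma tpair_ptens U V (u : U) (v : V) (phi : dual U) (psi : dual V) :
  tpair (ptens u v) phi psi = pairing phi u * pairing psi v.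
Proof. by rewrite /tpair ptensE pairingZr. Qed.

Lemma tmapE U V U' V' (f : 'Hom(U, U')) (g : 'Hom(V, V')) T phi :
  contract (tmap f g T) phi = g (contract T (transpose f phi)).
Proof. by rewrite /contract /tmap !comp_lfunE. Qed.

Lemma tmap_ptens U V U' V' (f : 'Hom(U, U')) (g : 'Hom(V, V')) u v :
  tmap f g (ptens u v) = ptens (f u) (g v).
Proof.
by apply: tensP => phi; rewrite tmapE !ptensE transposeE linearZ.
Qed.

Lemma tpair_tmap U V U' V' (f : 'Hom(U, U')) (g : 'Hom(V, V')) T phi psi :
  tpair (tmap f g T) phi psi = tpair T (transpose f phi) (transpose g psi).
Proof. by rewrite /tpair tmapE transposeE. Qed.

Lemma ptens_bilinear U V : bilinear_for *:%R *:%R (@ptens U V).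
Proof.
split=> [v a u u'|u a v v']; apply: tensP => phi; rewrite contractPl !ptensE.
  by rewrite !pairingr scalerDl scalerA.
by rewrite scalerDr !scalerA mulrC.
Qed.

Lemma tens_sum U V (T : tens U V) :
  T = \sum_(i < \dim {:U}) ptens (vbasis {:U})`_i (contract T (dbasis i)).
Proof.
apply: tensP => phi; rewrite {1}[phi]dual_sum /contract linear_sum sum_lfunE.
apply: eq_bigr => i _; rewrite linearZ /=; symmetry; exact: ptensE.
Qed.

Lemma tens_universal U V W (b : {bilinear U -> V -> W}) :
  exists! h : 'Hom(tens U V, W), forall u v, h (ptens u v) = b u v.
Proof.
pose F (T : tens U V) : W :=
  \sum_(i < \dim {:U}) b (vbasis {:U})`_i (contract T (dbasis i)).
have lin : linear F.
  move=> a S T; rewrite /F scaler_sumr -big_split; apply: eq_bigr => i _ /=.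
  by rewrite contractPl linearPr.
exists (linfun F); split=> [u v|g hg].
  rewrite linfunE // /F [u in RHS]vbasis_sum linear_sumlz.
  apply: eq_bigr => i _.
  by rewrite ptensE linearZr_LR linearZl_LR.
apply/lfunP => T; rewrite linfunE // /F {2}[T]tens_sum linear_sum.
by apply: eq_bigr => i _; exact: esym (hg _ _).
Qed.

End Tensor.

Section Zinbiel.
Variable K : fieldType.
Implicit Types A B V : vectType K.

Definition zinbiel A (m : {bilinear A -> A -> A}) : Prop :=
  forall x y z, m x (m y z) = m (m x y + m y x) z.

Section Multiplications.
Variables (A : vectType K) (m : {bilinear A -> A -> A}).

(* sub-adjacent commutative product *)
Definition subadj (x y : A) : A := m x y + m y x.

Definition Lmul (x : A) : 'End(A) := linfun (m x).
Definition Rmul (x : A) : 'End(A) := linfun (m^~ x).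

(* The sign is the one of the contragredient action:
   <L_x^* xi, y> = - <xi, L_x y>. *)
Definition Lstar (x : A) : 'End(dual A) := - transpose (Lmul x).
Definition Rstar (x : A) : 'End(dual A) := - transpose (Rmul x).

Lemma LmulE x y : Lmul x y = m x y.
Proof. by rewrite lfunE. Qed.

Lemma RmulE x y : Rmul x y = m y x.
Proof. by apply: linfunE => a u v; rewrite linearPl. Qed.

Lemma LstarE x (xi : dual A) y : pairing (Lstar x xi) y = - pairing xi (m x y).
Proof. by rewrite /Lstar opp_lfunE pairingNl transposeE LmulE. Qed.

Lemma RstarE x (xi : dual A) y : pairing (Rstar x xi) y = - pairing xi (m y x).
Proof. by rewrite /Rstar opp_lfunE pairingNl transposeE RmulE. Qed.

Lemma Lstar_linear : linear Lstar.
Proof.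
move=> a u v; apply/lfunP => xi; apply: dualP => y.
rewrite add_lfunE scale_lfunE !pairingl !LstarE linearPl !pairingr.
by rewrite opprD mulrN.
Qed.

Lemma Rstar_linear : linear Rstar.
Proof.
move=> a u v; apply/lfunP => xi; apply: dualP => y.
rewrite add_lfunE scale_lfunE !pairingl !RstarE linearPr !pairingr.
by rewrite opprD mulrN.
Qed.

HB.instance Definition _ := GRing.isLinear.Build _ _ _ _ Lstar Lstar_linear.
HB.instance Definition _ := GRing.isLinear.Build _ _ _ _ Rstar Rstar_linear.

End Multiplications.

Section DualMultiplications.
Variables (A : vectType K) (m : {bilinear dual A -> dual A -> dual A}).

(* For a product on A^*, the dual operators act on A itself: this is Lstar and
   Rstar, which act on A^**, transported along ev : A ~ A^**. *)
Definition Lstar_pre (xi : dual A) : 'End(A) :=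
  (ev_inv A \o Lstar m xi \o ev A)%VF.
Definition Rstar_pre (xi : dual A) : 'End(A) :=
  (ev_inv A \o Rstar m xi \o ev A)%VF.

Lemma Lstar_preE (xi eta : dual A) x :
  pairing eta (Lstar_pre xi x) = - pairing (m xi eta) x.
Proof. by rewrite !comp_lfunE ev_invE LstarE evE. Qed.

Lemma Rstar_preE (xi eta : dual A) x :
  pairing eta (Rstar_pre xi x) = - pairing (m eta xi) x.
Proof. by rewrite !comp_lfunE ev_invE RstarE evE. Qed.

Lemma Lstar_pre_linear : linear Lstar_pre.
Proof.
move=> a u v; apply/lfunP => x; apply: dual_inj => eta.
rewrite add_lfunE scale_lfunE !pairingr !Lstar_preE linearPl !pairingl.
by rewrite opprD mulrN.
Qed.

Lemma Rstar_pre_linear : linear Rstar_pre.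
Proof.
move=> a u v; apply/lfunP => x; apply: dual_inj => eta.
rewrite add_lfunE scale_lfunE !pairingr !Rstar_preE linearPr !pairingl.
by rewrite opprD mulrN.
Qed.

HB.instance Definition _ :=
  GRing.isLinear.Build _ _ _ _ Lstar_pre Lstar_pre_linear.
HB.instance Definition _ :=
  GRing.isLinear.Build _ _ _ _ Rstar_pre Rstar_pre_linear.

End DualMultiplications.

Record representation A (m : {bilinear A -> A -> A}) V
    (rho mu : {linear A -> 'End(V)}) : Prop := {
  rep_rho : forall x y, (rho x \o rho y)%VF = rho (m x y) + rho (m y x);
  rep_rho_mu : forall x y, (rho x \o mu y)%VF = mu (m x y);
  rep_mu : forall x y, mu (m x y) = (mu y \o rho x)%VF + (mu y \o mu x)%VF
}.

Record matched_pair A B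
    (mA : {bilinear A -> A -> A}) (mB : {bilinear B -> B -> B})
    (rho mu : {linear A -> 'End(B)}) (rho' mu' : {linear B -> 'End(A)}) :
    Prop := {
  mp_zinbielA : zinbiel mA;
  mp_zinbielB : zinbiel mB;
  mp_repA : representation mA rho mu;
  mp_repB : representation mB rho' mu';
  mp_eq1 : forall x u v,
    mB u (mu x v) + mu (rho' v x) u = mu x (mB u v + mB v u);
  mp_eq2 : forall x u v,
    rho x (mB u v) - mB (rho x u) v
    = rho (mu' u x) v + mB (mu x u) v + rho (rho' u x) v;
  mp_eq3 : forall x u v,
    mB u (rho x v) + mu (mu' v x) u - mB (mu x u) v
    = mB (rho x u) v + rho (mu' u x) v + rho (rho' u x) v;
  mp_eq4 : forall x y u,
    mA x (mu' u y) + mu' (rho y u) x = mu' u (mA x y + mA y x);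
  mp_eq5 : forall x y u,
    rho' u (mA x y) - mA (rho' u x) y
    = rho' (mu x u) y + mA (mu' u x) y + rho' (rho x u) y;
  mp_eq6 : forall x y u,
    mA x (rho' u y) + mu' (mu y u) x - mA (mu' u x) y
    = mA (rho' u x) y + rho' (mu x u) y + rho' (rho x u) y
}.

(* A member of the exterior square of the dual is an alternating form, which in
   characteristic 2 says more than skew-symmetry. *)
Record quadratic_zinbiel V (m : {bilinear V -> V -> V})
    (omega : {skew_symmetric V}) : Prop := {
  qz_zinbiel : zinbiel m;
  qz_alternating : forall x, omega x x = 0;
  qz_nondegenerate : nondegenerate omega;
  qz_invariant : forall x y z,
    omega (m x y) z = omega y (m x z + m z x)
}.

Definition subalgebra V (m : {bilinear V -> V -> V}) (W : {vspace V}) : Prop :=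
  {in W &, forall x y, m x y \in W}.

Definition isotropic V (omega : {skew_symmetric V}) (W : {vspace V}) : Prop :=
  {in W &, forall x y, omega x y = 0}.

Record manin_triple V (m : {bilinear V -> V -> V}) (omega : {skew_symmetric V})
    (V1 V2 : {vspace V}) : Prop := {
  mt_quadratic : quadratic_zinbiel m omega;
  mt_subalg1 : subalgebra m V1;
  mt_subalg2 : subalgebra m V2;
  mt_isotropic1 : isotropic omega V1;
  mt_isotropic2 : isotropic omega V2;
  mt_sum : (V1 + V2)%VS = fullv;
  mt_direct : directv (V1 + V2)
}.

Section Double.
Variable A : vectType K.

Definition dsum : vectType K := (A * dual A)%type.

Definition inA (x : A) : dsum := (x, 0).
Definition inAdual (xi : dual A) : dsum := (0, xi).

Definition subA : {vspace dsum} := limg (linfun inA).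
Definition subAdual : {vspace dsum} := limg (linfun inAdual).

(* omega (x + xi, y + eta) = <xi, y> - <eta, x> *)
Definition omega_std (u v : dsum) : K := pairing u.2 v.1 - pairing v.2 u.1.

Lemma mem_subA u : (u \in subA) = (u.2 == 0).
Proof.
have lin : linear inA.
  by move=> a x y; rewrite /inA; congr pair; rewrite /= scaler0 addr0.
apply/memv_imgP/eqP => [[x _ ->]|u2]; first by rewrite linfunE.
by exists u.1; rewrite ?memvf // linfunE // /inA -u2; case: u {u2}.
Qed.

Lemma mem_subAdual u : (u \in subAdual) = (u.1 == 0).
Proof.
have lin : linear inAdual.
  by move=> a x y; rewrite /inAdual; congr pair; rewrite /= scaler0 addr0.
apply/memv_imgP/eqP => [[x _ ->]|u1]; first by rewrite linfunE.
by exists u.2; rewrite ?memvf // linfunE // /inAdual -u1; case: u {u1}.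
Qed.

Lemma omega_std_bilinear : bilinear_for *%R (idfun \; *%R) omega_std.
Proof.
by split=> [v a u u'|u a v v']; rewrite /omega_std /= !pairingl !pairingr
  mulrBr opprD addrACA.
Qed.

Lemma omega_std_skew u v :
  omega_std u v = (-1) ^+ true * idfun (omega_std v u).
Proof. by rewrite expr1 mulN1r opprB. Qed.

HB.instance Definition _ :=
  bilinear_isBilinear.Build K dsum dsum K *%R (idfun \; *%R) omega_std
    omega_std_bilinear.
HB.instance Definition _ :=
  isHermitianSesquilinear.Build K dsum true idfun omega_std omega_std_skew.

End Double.

Section DualProduct.
Variables (V : vectType K) (delta : {linear V -> tens V V}).

(* The restriction of delta^* : (V (x) V)^* -> V^* to V^* (x) V^*. *)
Definition dual_prod (phi psi : dual V) : dual V :=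
  linfun (fun x => tpair (delta x) phi psi : K^o).

Lemma dual_prodE phi psi x :
  pairing (dual_prod phi psi) x = tpair (delta x) phi psi.
Proof.
apply: (@linfunE K V K^o (fun x => tpair (delta x) phi psi)) => a u v.
by rewrite linearP /tpair contractPl !pairingr.
Qed.

Lemma dual_prod_bilinear : bilinear_for *:%R *:%R dual_prod.
Proof.
split=> [v a u u'|u a v v']; apply: dualP => x;
  rewrite !pairingl !dual_prodE /tpair.
  by rewrite contractPr !pairingr.
by rewrite !pairingl.
Qed.

HB.instance Definition _ :=
  bilinear_isBilinear.Build K (dual V) (dual V) (dual V) *:%R *:%R dual_prod
    dual_prod_bilinear.

End DualProduct.

Section PredualProduct.
Variables (V : vectType K) (delta : {linear dual V -> tens (dual V) (dual V)}).

(* The same for a map on V^*, giving a product on V ~ V^**. *)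
Definition predual_prod (x y : V) : V :=
  ev_inv V (dual_prod delta (ev V x) (ev V y)).

Lemma predual_prodE x y (phi : dual V) :
  pairing phi (predual_prod x y) = tpair (delta phi) (ev V x) (ev V y).
Proof. by rewrite ev_invE dual_prodE. Qed.

Lemma predual_prod_bilinear : bilinear_for *:%R *:%R predual_prod.
Proof.
by split=> [v a u u'|u a v v'];
  rewrite /predual_prod linearP ?linearPl ?linearPr linearP.
Qed.

HB.instance Definition _ :=
  bilinear_isBilinear.Build K V V V *:%R *:%R predual_prod
    predual_prod_bilinear.

End PredualProduct.

(* 1-cocycles of the sub-adjacent commutative algebra of (A, m) with
   coefficients in (A (x) A; L (x) Id + Id (x) (L + R)) *)
Definition cocycle A (m : {bilinear A -> A -> A})
    (delta : {linear A -> tens A A}) : Prop :=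
  forall x y, delta (subadj m x y) =
    tmap (Lmul m x) \1%VF (delta y)
    + tmap \1%VF (Lmul m y + Rmul m y) (delta x).

Record zinbiel_bialgebra A (alpha : {linear A -> tens A A})
    (beta : {linear dual A -> tens (dual A) (dual A)}) : Prop := {
  zb_zinbiel_dual : zinbiel (dual_prod alpha);
  zb_zinbiel : zinbiel (predual_prod beta);
  zb_cocycle : cocycle (predual_prod beta) alpha;
  zb_cocycle_dual : cocycle (dual_prod alpha) beta
}.

End Zinbiel.

(* Main.v *)
Require Import Defs.
From HB Require Import structures.
From mathcomp Require Import all_boot all_order all_algebra ring.

Set Implicit Arguments.
Unset Strict Implicit.
Unset Printing Implicit Defensive.

Import GRing.Theory.
Local Open Scope ring_scope.

(* All three conditions concern one product on A + A^*: requiring omega to be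
   invariant forces the mixed products to be those given by the coadjoint
   operators.  For an invariant product,
     omega (x (y z) - (x y + y x) z) w = omega z (y * (x * w) - (y * x) * w)
   with * the sub-adjacent product, so the Zinbiel identity on A + A^* is the
   associativity of *.  As the associator of a commutative product is
   antisymmetric in its outer arguments and has vanishing cyclic sum, only two
   scalar identities involving both A and A^* remain, one for each type; these
   are the two cocycle conditions, [compatA] and [compatD] below. *)

(** * Testing the Zinbiel identity on summands *)

Section ZinbielGenerators.
Variables (K : fieldType) (V : vectType K) (m : {bilinear V -> V -> V}).
Implicit Types a b x y z : V.

Let zin x y z := m x (m y z) = m (m x y + m y x) z.

(** The identity is additive in each of its three arguments. [P] need not be closed under addition:
    it will be the union of the two summands of a direct sum. *)
Lemma zinbiel_on_summands (P : V -> Prop) :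
  (forall x, exists a b, [/\ P a, P b & x = a + b]) ->
  (forall x y z, P x -> P y -> P z -> zin x y z) -> zinbiel m.
Proof.
move=> dec zP.
have addl a b y z : zin a y z -> zin b y z -> zin (a + b) y z.
  move=> ha hb; rewrite /zin linearDl ha hb -linearDl.
  by congr (m _ z); rewrite linearDl linearDr addrACA.
have addm x a b z : zin x a z -> zin x b z -> zin x (a + b) z.
  move=> ha hb; rewrite /zin linearDl linearDr ha hb -linearDl.
  by congr (m _ z); rewrite linearDl linearDr addrACA.
have addr x y a b : zin x y a -> zin x y b -> zin x y (a + b).
  by move=> ha hb; rewrite /zin (linearDr m y) (linearDr m x) ha hb -linearDr.
move=> x y z.
have [x1 [x2 [Px1 Px2 ->]]] := dec x.
have [y1 [y2 [Py1 Py2 ->]]] := dec y.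
have [z1 [z2 [Pz1 Pz2 ->]]] := dec z.
by apply: addl; apply: addm; apply: addr; apply: zP.
Qed.

End ZinbielGenerators.

(** * Matched pairs and the product on the direct sum *)

Section Bowtie.
Variables (K : fieldType) (A B : vectType K).
Variables (mA : {bilinear A -> A -> A}) (mB : {bilinear B -> B -> B}).
Variables (rho mu : {linear A -> 'End(B)}) (rho' mu' : {linear B -> 'End(A)}).
Implicit Types (x y z : A) (u v w : B) (p q r : A * B).

(** [rho] and [rho'] act as left multiplications, [mu] and [mu'] as right ones. *)
Definition bowtie p q : A * B :=
  (mA p.1 q.1 + rho' p.2 q.1 + mu' q.2 p.1,
   mB p.2 q.2 + rho p.1 q.2 + mu q.1 p.2).

Lemma bowtie_bilinear : bilinear_for *:%R *:%R bowtie.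
Proof.
have lfunPl (U W : vectType K) (f : {linear U -> 'End(W)}) a s t e :
    f (a *: s + t) e = a *: f s e + f t e.
  by rewrite linearP add_lfunE scale_lfunE.
by split=> [q a p p'|p a q q']; apply: injective_projections => /=;
  rewrite !(linearPl, linearPr) !(lfunPl, linearP) !scalerDr !addrA;
  rewrite [LHS](ACl (1*3*5*2*4*6)).
Qed.

HB.instance Definition _ :=
  bilinear_isBilinear.Build K (A * B)%type (A * B)%type (A * B)%type
    *:%R *:%R bowtie bowtie_bilinear.

Let simpl0 := (linear0l, linear0r, linear0, @zero_lfunE, addr0, add0r).

Lemma bowtie_Al p y :
  bowtie p (y, 0) = (mA p.1 y + rho' p.2 y, mu y p.2).
Proof. by rewrite /bowtie /= !simpl0. Qed.

Lemma bowtie_Bl p v :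
  bowtie p (0, v) = (mu' v p.1, mB p.2 v + rho p.1 v).
Proof. by rewrite /bowtie /= !simpl0. Qed.

Lemma bowtie_Ar x q :
  bowtie (x, 0) q = (mA x q.1 + mu' q.2 x, rho x q.2).
Proof. by rewrite /bowtie /= !simpl0. Qed.

Lemma bowtie_Br u q :
  bowtie (0, u) q = (rho' u q.1, mB u q.2 + mu q.1 u).
Proof. by rewrite /bowtie /= !simpl0. Qed.

Lemma pairD x y u v : (x, u) + (y, v) = (x + y, u + v) :> A * B.
Proof. by []. Qed.

Let bowtieE := (bowtie_Al, bowtie_Bl, bowtie_Ar, bowtie_Br, pairD).

Let linD := (linearDl mA, linearDr mA, linearDl mB, linearDr mB).

(** A triple taken from the summands has one of eight types. The two pure types give the Zinbiel
    identities of [A] and [B]. Each of the six mixed types has two components: one concerns the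
    representation axioms, the other is one of the equations (1) to (6). *)
Lemma matched_pair_bowtie :
  matched_pair mA mB rho mu rho' mu' <-> zinbiel bowtie.
Proof.
have actD (U W : vectType K) (f : {linear U -> 'End(W)}) s t e :
    f (s + t) e = f s e + f t e.
  by rewrite linearD add_lfunE.
(* This brings (2) and (5) to the form of a component of the Zinbiel identity; [sub2] does the same
   for (3) and (6). *)
have sub1 (V : zmodType) (a c d e f : V) :
    a - c = d + e + f <-> a = (c + e) + (d + f).
  split=> [/eqP|->]; last by rewrite addrAC [c + e]addrC addrK addrC addrAC.
  by rewrite subr_eq => /eqP ->; rewrite [LHS](ACl ((4*2)*(1*3))).
have sub2 (V : zmodType) (a c d e f : V) :
    a - c = d + e + f <-> a = (c + d) + (f + e).
  by rewrite [d + e]addrC [f + e]addrC; exact: sub1.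
split=> [[zA zB [r1 r2 r3] [r1' r2' r3'] e1 e2 e3 e4 e5 e6]|zin0].
  apply: (@zinbiel_on_summands _ _ _ (fun p : A * B => p.1 = 0 \/ p.2 = 0)).
    move=> [x u]; exists (x, 0), (0, u); split; [by right|by left|].
    by rewrite pairD addr0 add0r.
  (* The types come in the order BBB, BBA, BAB, BAA, ABB, ABA, AAB, AAA. The pure types and
     equations (1) and (4) are closed at once. *)
  move=> [x u] [y v] [z w] /= [] -> [] -> [] ->; rewrite !bowtieE /= ?simpl0;
    congr pair => //.
  - by rewrite linearD -r1' comp_lfunE.
  - by rewrite -comp_lfunE r2' r3' add_lfunE !comp_lfunE linearD.
  - by rewrite !linD !actD; apply/sub2/e3.
  - by rewrite !linD !actD; apply/sub1/e5.
  - by rewrite r3 add_lfunE !comp_lfunE linearD addrC.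
  - by rewrite r3' add_lfunE !comp_lfunE linearD addrC.
  - by rewrite !linD !actD; apply/sub1/e2.
  - by rewrite !linD !actD; apply/sub2/e6.
  - by rewrite -comp_lfunE r2 r3 add_lfunE !comp_lfunE linearD.
  - by rewrite linearD -r1 comp_lfunE.
have zin p q r : bowtie p (bowtie q r) = bowtie (bowtie p q + bowtie q p) r.
  exact: zin0.
have AAB x y w := zin (x, 0) (y, 0) (0, w).
have BBA u v z := zin (0, u) (0, v) (z, 0).
have ABA x v z := zin (x, 0) (0, v) (z, 0).
have BAB u y w := zin (0, u) (y, 0) (0, w).
have BAA u y z := zin (0, u) (y, 0) (z, 0).
have ABB x v w := zin (x, 0) (0, v) (0, w).
split.
- move=> x y z; have := zin (x, 0) (y, 0) (z, 0).
  by rewrite !bowtieE /= ?simpl0; case.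
- move=> u v w; have := zin (0, u) (0, v) (0, w).
  by rewrite !bowtieE /= ?simpl0; case.
- split=> x y; apply/lfunP => w.
  + have := AAB x y w.
    by rewrite !bowtieE /= ?simpl0 comp_lfunE add_lfunE actD; case.
  (* The two members of this axiom are the left sides for the types ABA and BAA, whose right sides
     agree. *)
  + have := ABA x w y; rewrite !bowtieE /= ?simpl0 comp_lfunE => -[_ ->].
    by have := BAA w x y; rewrite !bowtieE /= ?simpl0 => -[_ ->]; rewrite addrC.
  + have := BAA w x y; rewrite !bowtieE /= ?simpl0 => -[_ ->].
    by rewrite add_lfunE !comp_lfunE addrC linearD.
- split=> u v; apply/lfunP => z.
  + have := BBA u v z.
    by rewrite !bowtieE /= ?simpl0 comp_lfunE add_lfunE actD; case.
  + have := BAB u z v; rewrite !bowtieE /= ?simpl0 comp_lfunE => -[-> _].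
    by have := ABB z u v; rewrite !bowtieE /= ?simpl0 => -[-> _]; rewrite addrC.
  + have := ABB z u v; rewrite !bowtieE /= ?simpl0 => -[-> _].
    by rewrite add_lfunE !comp_lfunE addrC linearD.
- by move=> x u v; have := BBA u v x; rewrite !bowtieE /= ?simpl0; case.
- move=> x u v; have := ABB x u v; rewrite !bowtieE /= ?simpl0 => -[_ e].
  by apply/sub1; rewrite e !linD !actD.
- move=> x u v; have := BAB u x v; rewrite !bowtieE /= ?simpl0 => -[_ e].
  by apply/sub2; rewrite e !linD !actD.
- by move=> x y u; have := AAB x y u; rewrite !bowtieE /= ?simpl0; case.
- move=> x y u; have := BAA u x y; rewrite !bowtieE /= ?simpl0 => -[e _].
  by apply/sub1; rewrite e !linD !actD.
- move=> x y u; have := ABA x u y; rewrite !bowtieE /= ?simpl0 => -[e _].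
  by apply/sub2; rewrite e !linD !actD.
Qed.

End Bowtie.

(** * The compatibility conditions as scalar identities *)

(** Reduces an equation to a known one with the same defect; once everything is paired, [ring]
    compares the defects. *)
Lemma eq_subr_trans (V : zmodType) (a b c d : V) :
  c = d -> a - b = c - d -> a = b.
Proof. by move=> -> /eqP; rewrite subrr subr_eq0 => /eqP. Qed.

(* The coadjoint operators are abstracted: unification up to unfolding of
   [Lstar_pre] against [Rstar_pre] would not end in reasonable time. *)
Section AdjointOperators.
Variables (K : fieldType) (A : vectType K).
Variables (mA : {bilinear A -> A -> A}).
Variables (mD : {bilinear dual A -> dual A -> dual A}).
Variables (L R : A -> dual A -> dual A) (L' R' : dual A -> A -> A).
Hypothesis LE : forall x xi y, pairing (L x xi) y = - pairing xi (mA x y).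
Hypothesis RE : forall x xi y, pairing (R x xi) y = - pairing xi (mA y x).
Hypothesis L'E : forall xi x eta,
  pairing eta (L' xi x) = - pairing (mD xi eta) x.
Hypothesis R'E : forall xi x eta,
  pairing eta (R' xi x) = - pairing (mD eta xi) x.
Implicit Types (x y z : A) (xi eta zeta u v : dual A).

(** This and its three variants trade a coadjoint operator inside a product of [A^*] for one inside
    a product of [A], which gives paired identities a normal form. *)
Lemma pairing_LstarL x xi eta y :
  pairing (mD (L x xi) eta) y = pairing xi (mA x (R' eta y)).
Proof. by rewrite -[LHS]opprK -R'E LE opprK. Qed.

Lemma pairing_LstarR x xi eta y :
  pairing (mD eta (L x xi)) y = pairing xi (mA x (L' eta y)).
Proof. by rewrite -[LHS]opprK -L'E LE opprK. Qed.

Lemma pairing_RstarL x xi eta y :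
  pairing (mD (R x xi) eta) y = pairing xi (mA (R' eta y) x).
Proof. by rewrite -[LHS]opprK -R'E RE opprK. Qed.

Lemma pairing_RstarR x xi eta y :
  pairing (mD eta (R x xi)) y = pairing xi (mA (L' eta y) x).
Proof. by rewrite -[LHS]opprK -L'E RE opprK. Qed.

(** The cocycle condition on [alpha] paired with [xi] and [eta], freed of tensors so that it can be
    compared with the matched pair equations. *)
Definition compatA : Prop := forall x y xi eta,
  pairing (mD xi eta) (subadj mA x y) =
  - pairing xi (mA x (R' eta y)) - pairing eta (subadj mA y (L' xi x)).

Definition compatD : Prop := forall xi eta x y,
  pairing (subadj mD xi eta) (mA x y) =
  - pairing eta (mA (L' xi x) y) - pairing xi (mA x (L' eta y + R' eta y)).

Local Notation rho x := (fun xi => - L x xi - R x xi).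
Local Notation rho' xi := (fun x => - L' xi x - R' xi x).

Let E := (LE, RE, L'E, R'E, pairing_LstarL, pairing_LstarR,
  pairing_RstarL, pairing_RstarR,
  linearDl mA, linearDr mA, linearNl mA, linearNr mA,
  linearDl mD, linearDr mD, linearNl mD, linearNr mD,
  pairingDl, pairingDr, pairingNl, pairingNr).

Lemma compatA_eq4 : compatA <-> forall x y u,
  mA x (R' u y) + R' (rho y u) x = R' u (subadj mA x y).
Proof.
split=> [cA x y u|e4 x y xi eta].
  apply: dual_inj => eta; apply: eq_subr_trans (cA x y eta u) _.
  by rewrite /subadj !E; ring.
have := congr1 (pairing xi) (e4 x y eta).
move=> /eq_subr_trans; apply.
by rewrite /subadj !E; ring.
Qed.

Lemma compatD_eq1 : compatD <-> forall x u v,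
  mD u (R x v) + R (rho' v x) u = R x (subadj mD u v).
Proof.
split=> [cD x u v|e1 xi eta x y].
  apply: dualP => z; apply: eq_subr_trans (cD u v z x) _.
  by rewrite /subadj !E; ring.
have := congr1 (fun zeta => pairing zeta x) (e1 y xi eta).
move=> /eq_subr_trans; apply.
by rewrite /subadj !E; ring.
Qed.

Lemma compatA_eq2 : compatA -> forall x u v,
  rho x (mD u v) - mD (rho x u) v =
  rho (R' u x) v + mD (R x u) v + rho (rho' u x) v.
Proof.
move=> cA x u v; apply: dualP => z; apply: eq_subr_trans (cA x z u v) _.
by rewrite /subadj !E; ring.
Qed.

(** The left side of [compatA] is symmetric in [x] and [y]; equation (3) says that the right side is
    symmetric too. *)
Lemma compatA_eq3 : compatA -> forall x u v,
  mD u (rho x v) + R (R' v x) u - mD (R x u) v =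
  mD (rho x u) v + rho (R' u x) v + rho (rho' u x) v.
Proof.
move=> cA x u v; apply: dualP => z.
have := congr2 (fun a b => a - b) (cA x z u v) (cA z x u v).
move=> /eq_subr_trans; apply.
by rewrite /subadj !E; ring.
Qed.

Lemma compatD_eq5 : compatD -> forall x y u,
  rho' u (mA x y) - mA (rho' u x) y =
  rho' (R x u) y + mA (R' u x) y + rho' (rho x u) y.
Proof.
move=> cD x y u; apply: dual_inj => eta; apply: eq_subr_trans (cD u eta x y) _.
by rewrite /subadj !E; ring.
Qed.

(** As for (3): equation (6) is the symmetry of the right side of [compatD] in [xi] and [eta]. *)
Lemma compatD_eq6 : compatD -> forall x y u,
  mA x (rho' u y) + R' (R y u) x - mA (R' u x) y =
  mA (rho' u x) y + rho' (R x u) y + rho' (rho x u) y.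
Proof.
move=> cD x y u; apply: dual_inj => eta.
have := congr2 (fun a b => a - b) (cD u eta x y) (cD eta u x y).
move=> /eq_subr_trans; apply.
by rewrite /subadj !E; ring.
Qed.

(** This is the invariance of [omega_std] under the product on [A + A^*], in components; it comes
    from the adjunctions. *)
Lemma omega_invariant_components x y z u v w :
  pairing (mD u v + rho x v + R y u) z
  - pairing w (mA x y + rho' u y + R' v x) =
  pairing v (mA x z + rho' u z + R' w x + (mA z x + rho' w x + R' u z))
  - pairing (mD u w + rho x w + R z u + (mD w u + rho z u + R x w)) y.
Proof. by rewrite !E; ring. Qed.

End AdjointOperators.

(** * Separating tensors by pairings *)

Section TensorPairing.
Variable K : fieldType.

Lemma tpairP (U V : vectType K) (S T : tens U V) :
  (forall (phi : dual U) (psi : dual V), tpair S phi psi = tpair T phi psi) ->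
  S = T.
Proof.
by move=> e; apply: tensP => phi; apply: dual_inj => psi; exact: (e phi psi).
Qed.

Lemma tpairD (U V : vectType K) (S T : tens U V) (phi : dual U) (psi : dual V) :
  tpair (S + T) phi psi = tpair S phi psi + tpair T phi psi.
Proof. by rewrite /tpair /contract add_lfunE pairingDr. Qed.

End TensorPairing.

(** * Coadjoint representations, cocycles and compatibility *)

Section DoubleProducts.
Variables (K : fieldType) (A : vectType K).
Variables (mA : {bilinear A -> A -> A}).
Variables (mD : {bilinear dual A -> dual A -> dual A}).
Implicit Types (x y z : A) (xi eta zeta : dual A).

Local Notation L' := (fun xi x => Lstar_pre mD xi x).
Local Notation R' := (fun xi x => Rstar_pre mD xi x).
Local Notation compatA := (compatA mA mD L' R').
Local Notation compatD := (compatD mA mD L' R').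
Local Notation rho := ((\- Lstar mA) \- Rstar mA).
Local Notation rho' := ((\- Lstar_pre mD) \- Rstar_pre mD).

Let adjL x xi y : pairing (Lstar mA x xi) y = - pairing xi (mA x y) :=
  LstarE mA x xi y.
Let adjR x xi y : pairing (Rstar mA x xi) y = - pairing xi (mA y x) :=
  RstarE mA x xi y.
Let adjL' xi x eta :
    pairing eta (Lstar_pre mD xi x) = - pairing (mD xi eta) x :=
  Lstar_preE mD xi eta x.
Let adjR' xi x eta :
    pairing eta (Rstar_pre mD xi x) = - pairing (mD eta xi) x :=
  Rstar_preE mD xi eta x.

Lemma rhoE x xi : rho x xi = - Lstar mA x xi - Rstar mA x xi.
Proof. by rewrite add_lfunE !opp_lfunE. Qed.

Lemma rho'E xi x : rho' xi x = - Lstar_pre mD xi x - Rstar_pre mD xi x.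
Proof. by rewrite add_lfunE !opp_lfunE. Qed.

Lemma pairing_rho x xi y : pairing (rho x xi) y = pairing xi (subadj mA x y).
Proof.
by rewrite rhoE !pairingl LstarE RstarE pairingDr !opprK.
Qed.

Lemma pairing_rho' xi x eta :
  pairing eta (rho' xi x) = pairing (subadj mD xi eta) x.
Proof.
by rewrite rho'E !pairingr Lstar_preE Rstar_preE pairingDl !opprK.
Qed.

(** [rho x] is the transpose of multiplication by [x] in the sub-adjacent algebra. After pairing,
    the Zinbiel identity turns all nested products into left-bracketed ones. *)
Lemma rho_representation : zinbiel mA -> representation mA rho (Rstar mA).
Proof.
move=> zA; split=> x y; apply/lfunP => xi; apply: dualP => z.
- rewrite add_lfunE !comp_lfunE !pairingDl !pairing_rho.
  by rewrite /subadj !(zA, linearDr, linearDl) !pairingDr; ring.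
- rewrite comp_lfunE pairing_rho !RstarE.
  by rewrite /subadj !(zA, linearDr, linearDl) !pairingDr; ring.
- rewrite add_lfunE !comp_lfunE pairingDl !RstarE pairing_rho.
  by rewrite /subadj !(zA, linearDr, linearDl) !pairingDr; ring.
Qed.

Lemma rho'_representation : zinbiel mD -> representation mD rho' (Rstar_pre mD).
Proof.
move=> zD; split=> xi eta; apply/lfunP => x; apply: dual_inj => zeta.
- rewrite add_lfunE !comp_lfunE !pairingDr !pairing_rho'.
  by rewrite /subadj !(zD, linearDr, linearDl) !pairingDl; ring.
- rewrite comp_lfunE pairing_rho' !Rstar_preE.
  by rewrite /subadj !(zD, linearDr, linearDl) !pairingDl; ring.
- rewrite add_lfunE !(comp_lfunE (Rstar_pre mD eta)) pairingDr.
  rewrite !Rstar_preE pairing_rho'.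
  by rewrite /subadj !(zD, linearDr, linearDl) !pairingDl; ring.
Qed.

(** Under the pairing, the operators on the tensor square move to [xi] and [eta] as transposes.
    These are the negatives of the coadjoint operators, whence the minus signs in [compatA]. *)
Lemma cocycleA_iff (alpha : {linear A -> tens A A}) :
  (forall x xi eta, tpair (alpha x) xi eta = pairing (mD xi eta) x) ->
  cocycle mA alpha <-> compatA.
Proof.
move=> alphaE.
have LE x y xi eta : tpair (tmap (Lmul mA x) \1%VF (alpha y)) xi eta
    = - pairing xi (mA x (Rstar_pre mD eta y)).
  rewrite tpair_tmap alphaE -(pairing_LstarL adjL adjR') -pairingNl -linearNl.
  congr (pairing (mD _ _) y); apply: dualP => z.
    by rewrite pairingNl LstarE opprK transposeE LmulE.
  by rewrite transposeE id_lfunE.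
have RE x y xi eta : tpair (tmap \1%VF (Lmul mA y + Rmul mA y) (alpha x)) xi eta
    = - pairing eta (subadj mA y (Lstar_pre mD xi x)).
  rewrite tpair_tmap alphaE /subadj pairingDr.
  rewrite -(pairing_LstarR adjL adjL') -(pairing_RstarR adjR adjL').
  rewrite -pairingDl -linearDr -pairingNl -linearNr.
  congr (pairing (mD _ _) x); apply: dualP => z.
    by rewrite transposeE id_lfunE.
  rewrite pairingNl pairingDl LstarE RstarE opprD !opprK.
  by rewrite transposeE add_lfunE LmulE RmulE pairingDr.
split=> [co x y xi eta|co x y]; first by rewrite -alphaE co tpairD LE RE.
by apply: tpairP => xi eta; rewrite tpairD LE RE alphaE co.
Qed.

Lemma cocycleD_iff (beta : {linear dual A -> tens (dual A) (dual A)}) :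
  (forall xi x y, tpair (beta xi) (ev A x) (ev A y) = pairing xi (mA x y)) ->
  cocycle mD beta <-> compatD.
Proof.
move=> betaE.
have LE xi eta x y :
    tpair (tmap (Lmul mD xi) \1%VF (beta eta)) (ev A x) (ev A y)
    = - pairing eta (mA (Lstar_pre mD xi x) y).
  rewrite tpair_tmap -pairingNr -linearNl -betaE.
  congr (tpair (beta _) _ _); apply: dualP => z.
    by rewrite transposeE LmulE !evE pairingNr Lstar_preE opprK.
  by rewrite transposeE id_lfunE.
have RE xi eta x y :
    tpair (tmap \1%VF (Lmul mD eta + Rmul mD eta) (beta xi)) (ev A x) (ev A y)
    = - pairing xi (mA x (Lstar_pre mD eta y + Rstar_pre mD eta y)).
  rewrite tpair_tmap -pairingNr -linearNr -betaE.
  congr (tpair (beta _) _ _); apply: dualP => z.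
    by rewrite transposeE id_lfunE.
  rewrite transposeE add_lfunE LmulE RmulE !evE pairingDl pairingNr pairingDr.
  by rewrite Lstar_preE Rstar_preE opprD !opprK.
split=> [co xi eta x y|co xi eta]; first by rewrite -betaE co tpairD LE RE.
(* Every element of the bidual is an evaluation, so vectors of [A] suffice as tests. *)
apply: tpairP => f g; rewrite -[f]ev_invK -[g]ev_invK.
by rewrite tpairD LE RE betaE co.
Qed.

Lemma bialgebra_iff (alpha : {linear A -> tens A A})
    (beta : {linear dual A -> tens (dual A) (dual A)}) :
  zinbiel mA -> zinbiel mD ->
  (forall x xi eta, tpair (alpha x) xi eta = pairing (mD xi eta) x) ->
  (forall xi x y, tpair (beta xi) (ev A x) (ev A y) = pairing xi (mA x y)) ->
  zinbiel_bialgebra alpha beta <-> compatA /\ compatD.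
Proof.
move=> zA zD alphaE betaE.
have mDE xi eta : dual_prod alpha xi eta = mD xi eta.
  by apply: dualP => x; rewrite dual_prodE alphaE.
have mAE x y : predual_prod beta x y = mA x y.
  by apply: dual_inj => xi; rewrite predual_prodE betaE.
(* The two products agree only pointwise, so the condition is transported through the multiplication
   operators. *)
have coA : cocycle (predual_prod beta) alpha <-> cocycle mA alpha.
  have LE x : Lmul (predual_prod beta) x = Lmul mA x.
    by apply/lfunP => y; rewrite !LmulE /= mAE.
  have RE x : Rmul (predual_prod beta) x = Rmul mA x.
    by apply/lfunP => y; rewrite !RmulE /= mAE.
  by split=> co x y; move: (co x y); rewrite /subadj !LE !RE /= !mAE.
have coD : cocycle (dual_prod alpha) beta <-> cocycle mD beta.
  have LE xi : Lmul (dual_prod alpha) xi = Lmul mD xi.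
    by apply/lfunP => eta; rewrite !LmulE /= mDE.
  have RE xi : Rmul (dual_prod alpha) xi = Rmul mD xi.
    by apply/lfunP => eta; rewrite !RmulE /= mDE.
  by split=> co x y; move: (co x y); rewrite /subadj !LE !RE /= !mDE.
split=> [[_ _ /coA cA /coD cD]|[cA cD]].
  by split; [apply/(cocycleA_iff alphaE) | apply/(cocycleD_iff betaE)].
split.
- by move=> x y z; rewrite /= !mDE.
- by move=> x y z; rewrite /= !mAE.
- by apply/coA/(cocycleA_iff alphaE).
- by apply/coD/(cocycleD_iff betaE).
Qed.

Lemma matched_pair_iff : zinbiel mA -> zinbiel mD ->
  matched_pair mA mD rho (Rstar mA) rho' (Rstar_pre mD) <-> compatA /\ compatD.
Proof.
move=> zA zD; split=> [[_ _ _ _ e1 _ _ e4 _ _]|[cA cD]].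
  split.
    apply/(compatA_eq4 adjL adjR adjL' adjR') => x y u.
    by rewrite -[RHS]e4 rhoE.
  apply/(compatD_eq1 R' adjR adjL') => x u v.
  by rewrite -[RHS]e1 rho'E.
split=> //; [exact: rho_representation | exact: rho'_representation| ..].
- by move=> x u v; rewrite rho'E; exact: ((compatD_eq1 R' adjR adjL').1 cD).
- move=> x u v; rewrite !rhoE rho'E.
  exact: (compatA_eq2 adjL adjR adjR' cA).
- move=> x u v; rewrite !rhoE rho'E.
  exact: (compatA_eq3 adjL adjR adjL' adjR' cA).
- move=> x y u; rewrite rhoE.
  exact: ((compatA_eq4 adjL adjR adjL' adjR').1 cA).
- move=> x y u; rewrite !rho'E rhoE.
  exact: (compatD_eq5 adjL adjR adjL' adjR' cD).
- move=> x y u; rewrite !rho'E rhoE.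
  exact: (compatD_eq6 adjL adjR adjL' adjR' cD).
Qed.

End DoubleProducts.

(** * Manin triples and invariant products *)

Section Manin.
Variables (K : fieldType) (A : vectType K).
Implicit Types (p q r : dsum A) (m : {bilinear dsum A -> dsum A -> dsum A}).

Lemma dsum_split p : p = inA p.1 + inAdual p.2.
Proof.
by apply: injective_projections; rewrite /= ?addr0 ?add0r.
Qed.

(** Pairing with [A] recovers the component in [A^*], and pairing with [A^*] the one in [A]. *)
Lemma omega_std_inj p q :
  (forall z, omega_std p (inA z) = omega_std q (inA z)) ->
  (forall zeta, omega_std p (inAdual zeta) = omega_std q (inAdual zeta)) ->
  p = q.
Proof.
rewrite /omega_std /= => eA eD; apply: injective_projections.
  apply: dual_inj => zeta; apply: oppr_inj.
  by have := eD zeta; rewrite !pairing0r !sub0r.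
by apply: dualP => z; have := eA z; rewrite !pairing0l !subr0.
Qed.

Lemma omega_std_nondegenerate : nondegenerate (@omega_std K A).
Proof.
rewrite /nondegenerate -subv0; apply/subvP => p /mem_orthovP /= op.
rewrite memv0; apply/eqP; apply: omega_std_inj => z;
  by rewrite op ?memvf // /omega_std /= !(pairing0l, pairing0r) subr0.
Qed.

Lemma isotropic_subA : isotropic (@omega_std K A) (subA A).
Proof.
move=> p q; rewrite !mem_subA /= /omega_std => /eqP-> /eqP->.
by rewrite !pairing0l subr0.
Qed.

Lemma isotropic_subAdual : isotropic (@omega_std K A) (subAdual A).
Proof.
move=> p q; rewrite !mem_subAdual /= /omega_std => /eqP-> /eqP->.
by rewrite !pairing0r subr0.
Qed.

Lemma subA_add_subAdual : (subA A + subAdual A)%VS = fullv.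
Proof.
apply/eqP; rewrite eqEsubv subvf; apply/subvP => p _.
by rewrite [p]dsum_split memv_add // ?mem_subA ?mem_subAdual.
Qed.

Lemma directv_subA_subAdual : directv (subA A + subAdual A).
Proof.
apply/directv_addP/eqP; rewrite -subv0; apply/subvP => p.
rewrite memv_cap mem_subA mem_subAdual memv0 => /andP[p2 p1].
by rewrite [p]dsum_split (eqP p1) (eqP p2) addr0.
Qed.

Definition omega_invariant m : Prop := forall p q r,
  omega_std (m p q) r = omega_std q (m p r + m r p).

(* A mixed product is determined by its pairings with A and A^*, and invariance
   turns each of them into a product taken inside A or inside A^*. *)
Lemma omega_invariant_unique m m' :
  omega_invariant m -> omega_invariant m' ->
  (forall x y, m (inA x) (inA y) = m' (inA x) (inA y)) ->
  (forall xi eta,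
     m (inAdual xi) (inAdual eta) = m' (inAdual xi) (inAdual eta)) ->
  forall p q, m p q = m' p q.
Proof.
move=> inv inv' eA eD.
(* The right side of the invariance condition is symmetric in [p] and [r]. *)
have swap p q r : omega_std (m p q) r = omega_std (m r q) p.
  by rewrite !inv addrC.
have swap' p q r : omega_std (m' p q) r = omega_std (m' r q) p.
  by rewrite !inv' addrC.
have eAD x eta : m (inA x) (inAdual eta) = m' (inA x) (inAdual eta).
  apply: omega_std_inj => [z|zeta]; first by rewrite inv inv' !eA.
  by rewrite swap swap' eD.
have eDA xi y : m (inAdual xi) (inA y) = m' (inAdual xi) (inA y).
  apply: omega_std_inj => [z|zeta]; first by rewrite swap swap' eA.
  by rewrite inv inv' !eD.
move=> p q; rewrite [p]dsum_split [q]dsum_split.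
by rewrite !linearDl !linearDr eA eD eAD eDA.
Qed.

Variables (mA : {bilinear A -> A -> A}).
Variables (mD : {bilinear dual A -> dual A -> dual A}).

Definition double_prod : dsum A -> dsum A -> dsum A :=
  bowtie mA mD ((\- Lstar mA) \- Rstar mA) (Rstar mA)
    ((\- Lstar_pre mD) \- Rstar_pre mD) (Rstar_pre mD).

HB.instance Definition _ :=
  bilinear_isBilinear.Build K (dsum A) (dsum A) (dsum A) *:%R *:%R double_prod
    (bowtie_bilinear mA mD ((\- Lstar mA) \- Rstar mA) (Rstar mA)
      ((\- Lstar_pre mD) \- Rstar_pre mD) (Rstar_pre mD)).

Lemma double_prod_inA x y : double_prod (inA x) (inA y) = inA (mA x y).
Proof.
by rewrite /double_prod /inA bowtie_Al /= !(linear0, zero_lfunE, addr0).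
Qed.

Lemma double_prod_inAdual xi eta :
  double_prod (inAdual xi) (inAdual eta) = inAdual (mD xi eta).
Proof.
by rewrite /double_prod /inAdual bowtie_Bl /= !(linear0, zero_lfunE, addr0).
Qed.

Lemma double_prod_invariant : omega_invariant double_prod.
Proof.
move=> [x u] [y v] [z w]; rewrite /omega_std /double_prod /bowtie /=.
rewrite !rhoE !rho'E.
exact: (omega_invariant_components (LstarE mA) (RstarE mA)
  (fun xi x eta => Lstar_preE mD xi eta x)
  (fun xi x eta => Rstar_preE mD xi eta x)).
Qed.

(** By uniqueness, any such [m] agrees with [double_prod], for which all requirements of a Manin
    triple but the Zinbiel identity have been established. *)
Lemma manin_iff :
  zinbiel double_prod <->
  exists m : {bilinear dsum A -> dsum A -> dsum A},
    [/\ forall x y, m (inA x) (inA y) = inA (mA x y),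
        forall xi eta, m (inAdual xi) (inAdual eta) = inAdual (mD xi eta)
      & manin_triple m (@omega_std K A) (subA A) (subAdual A)].
Proof.
split=> [zin|[m [mAE mDE [[zin _ _ inv] _ _ _ _ _ _]]]].
  exists double_prod; split;
    [exact: double_prod_inA | exact: double_prod_inAdual | split].
  - split.
    + exact: zin.
    + by move=> p; exact: subrr.
    + exact: omega_std_nondegenerate.
    + exact: double_prod_invariant.
  - move=> p q; rewrite !mem_subA => /eqP p2 /eqP q2.
    rewrite [p]dsum_split [q]dsum_split p2 q2 !addr0.
    exact/eqP/(congr1 snd (double_prod_inA p.1 q.1)).
  - move=> p q; rewrite !mem_subAdual => /eqP p1 /eqP q1.
    rewrite [p]dsum_split [q]dsum_split p1 q1 !add0r.
    exact/eqP/(congr1 fst (double_prod_inAdual p.2 q.2)).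
  - exact: isotropic_subA.
  - exact: isotropic_subAdual.
  - exact: subA_add_subAdual.
  - exact: directv_subA_subAdual.
have e : forall p q, m p q = double_prod p q.
  apply: omega_invariant_unique; [exact: inv|exact: double_prod_invariant| |].
    by move=> x y; rewrite mAE /= double_prod_inA.
  by move=> xi eta; rewrite mDE /= double_prod_inAdual.
by move=> p q r; have := zin p q r; rewrite !e.
Qed.

End Manin.

Theorem theorem2p17 (K : fieldType) (A : vectType K)
  (mA : {bilinear A -> A -> A})
  (mD : {bilinear dual A -> dual A -> dual A})
  (alpha : {linear A -> tens A A})
  (beta : {linear dual A -> tens (dual A) (dual A)})
  (zinbiel_mA : zinbiel mA) (zinbiel_mD : zinbiel mD)
  (alpha_dual : forall (x : A) (xi eta : dual A),
     tpair (alpha x) xi eta = pairing (mD xi eta) x)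
  (beta_dual : forall (xi : dual A) (x y : A),
     tpair (beta xi) (ev A x) (ev A y) = pairing xi (mA x y)) :
  let bialgebra := zinbiel_bialgebra alpha beta in
  let matched :=
    matched_pair mA mD
      ((\- Lstar mA) \- Rstar mA) (Rstar mA)
      ((\- Lstar_pre mD) \- Rstar_pre mD) (Rstar_pre mD) in
  let manin :=
    exists m : {bilinear dsum A -> dsum A -> dsum A},
      [/\ forall x y, m (inA x) (inA y) = inA (mA x y),
          forall xi eta, m (inAdual xi) (inAdual eta) = inAdual (mD xi eta)
        & manin_triple m (@omega_std K A) (subA A) (subAdual A)] in
  (bialgebra <-> matched) /\ (matched <-> manin).
Proof.
move=> bialgebra matched manin; split.
  (* Both conditions amount to [compatA] together with [compatD]. *)
  rewrite /matched matched_pair_iff //.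
  exact: (bialgebra_iff zinbiel_mA zinbiel_mD alpha_dual beta_dual).
(* The product [bowtie] for the coadjoint actions is [double_prod] by definition. *)
rewrite /matched matched_pair_bowtie; exact: manin_iff.
Qed.
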